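(* Suppose that the Erdős–Sós conjecture holds for all trees, i.e., for every integer $\ell\ge 1$, every tree $S$ on $\ell+1$ vertices and every positive integer $n$, we have $\mathrm{ex}(n,S)\le \frac{\ell-1}{2}n$. Let $k\ge 1$ and $r\ge 2$ be integers, let $T$ be a tree on $k+1$ vertices and let $n$ be a positive integer. If $k > r+1>3$, then \[ \mathrm{ex}_r(n,\text{Berge-}T) \leq \frac{n}{k}\binom{k}{r}, \] and moreover, if $k$ divides $n$, this bound is sharp (i.e., equality holds). If $k \leq r+1$, then \[ \mathrm{ex}_r(n,\text{Berge-}T) \leq \frac{k-1}{2}n. \]
   Context: All graphs and hypergraphs are finite and simple. A hypergraph $\mathcal{H}$ contains a Berge-$F$ (Berge copy of the graph $F$) if there are an injection $\varphi:V(F)\to V(\mathcal{H})$ and an injection $f:E(F)\to E(\mathcal{H})$ with $\{\varphi(u),\varphi(v)\}\subset f(uv)$ for every edge $uv\in E(F)$; otherwise it is Berge-$F$-free. $\mathrm{ex}_r(n,\text{Berge-}F)$ is the maximum number of hyperedges in an $n$-vertex $r$-uniform Berge-$F$-free hypergraph. $\mathrm{ex}(n,F)$ is the maximum number of edges in an $n$-vertex graph with no (not necessarily induced) subgraph isomorphic to $F$. *)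

(* Defs.v *)
From mathcomp Require Import all_boot all_order all_algebra.

Set Implicit Arguments.
Unset Strict Implicit.
Unset Printing Implicit Defensive.

(* A simple hypergraph on the vertex set V is its set of hyperedges, without
   repetition; a simple graph is a 2-uniform hypergraph. *)
Definition hypergraph (V : finType) := {set {set V}}.

Definition uniform (r : nat) (V : finType) (H : hypergraph V) : bool :=
  [forall e in H, #|e| == r].

Definition is_graph (V : finType) (G : hypergraph V) : bool := uniform 2 G.

Definition adj (V : finType) (G : hypergraph V) : rel V :=
  fun u v => [set u; v] \in G.

Definition connected (V : finType) (G : hypergraph V) : Prop :=
  0 < #|V| /\ forall u v : V, connect (adj G) u v.

(* [ucycle] accepts the closed walk u, v, u along a single edge as a cycle of
   size 2, hence the size condition. *)
Definition acyclic (V : finType) (G : hypergraph V) : Prop :=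
  forall c : seq V, ucycle (adj G) c -> size c < 3.

Definition is_tree (V : finType) (G : hypergraph V) : Prop :=
  [/\ is_graph G, connected G & acyclic G].

(* Some subgraph of G, not necessarily induced, is isomorphic to F. *)
Definition contains_subgraph (U V : finType)
    (F : hypergraph U) (G : hypergraph V) : bool :=
  [exists phi : {ffun U -> V},
    injectiveb phi &&
    [forall u, forall v, adj F u v ==> adj G (phi u) (phi v)]].

(* The injection f : E(F) -> E(H) is given as a map on all subsets of U, of
   which only the values on E(F) matter. *)
Definition contains_berge (U V : finType)
    (F : hypergraph U) (H : hypergraph V) : bool :=
  [exists phi : {ffun U -> V}, exists f : {ffun {set U} -> {set V}},
    [&& injectiveb phi,
        dinjectiveb f (mem F),
        [forall e in F, f e \in H]
      & [forall u, forall v,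
          adj F u v ==> ([set phi u; phi v] \subset f [set u; v])]]].

(* When F has at least one edge, both maxima below range over a nonempty
   family, as the edgeless (hyper)graph qualifies. *)
Definition ex (n : nat) (U : finType) (F : hypergraph U) : nat :=
  \max_(G : hypergraph 'I_n | is_graph G && ~~ contains_subgraph F G) #|G|.

Definition ex_berge (r n : nat) (U : finType) (F : hypergraph U) : nat :=
  \max_(H : hypergraph 'I_n | uniform r H && ~~ contains_berge F H) #|H|.

Definition erdos_sos_conjecture : Prop :=
  forall (l : nat) (U : finType) (S : hypergraph U) (n : nat),
    1 <= l -> is_tree S -> #|U| = l.+1 -> 0 < n ->
    ((ex n S)%:R <= (l%:R - 1) / 2%:R * n%:R :> rat)%R.

(* Main.v *)
Require Import Defs.
From mathcomp Require Import all_boot all_order all_algebra.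
From mathcomp Require Import zify.

Set Implicit Arguments.
Unset Strict Implicit.
Unset Printing Implicit Defensive.

(* Match hyperedges with the vertex pairs they contain.  A König-type argument
   splits the vertex pairs used into a red graph R and a blue graph B such that
   all of R and B can be matched simultaneously, the hyperedges left outside a
   family X number exactly |B|, and every hyperedge of X is a clique of R.
   Hence R + B contains no copy of T, and |H| <= |B| + (number of r-cliques of R).
   If v is a vertex of T with T - v connected, then T - v does not embed into a
   neighbourhood of a T-free graph, so by induction on the clique size the
   Erdős–Sós bound controls the r-cliques of R by its edges.  For sharpness, take
   n / k disjoint complete r-uniform hypergraphs on k vertices: a Berge-T would
   stay inside one of them, which has too few vertices. *)

(** * Bipartite matching: Hall and König *)

(** Induction on [#|A|]. A nonempty proper subset [X] with at most [#|X|] neighbours is matched into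
    them, and [A :\: X] outside them. If no such [X] exists, Hall's condition has slack 1, so any
    [a] takes any neighbour [b] and the other vertices can do without [b]. *)
Lemma hall (aT bT : finType) (b0 : bT) (A : {set aT}) (E : aT -> {set bT}) :
  (forall X : {set aT}, X \subset A -> #|X| <= #|\bigcup_(x in X) E x|) ->
  exists f : aT -> bT, {in A &, injective f} /\ {in A, forall x, f x \in E x}.
Proof.
have [m] := ubnP #|A|; elim: m => // m IH in A E *; rewrite ltnS => leAm hallA.
have [->|[a aA]] := set_0Vmem A.
  by exists (fun=> b0); split=> x; rewrite inE.
have [/existsP[X /and4P[XA X0 XnA leX]]|/existsPn tightN] := boolP [exists X : {set aT},
    [&& X \subset A, X != set0, X != A & #|\bigcup_(x in X) E x| <= #|X|]].
  set N := \bigcup_(x in X) E x in leX.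
  have ltXA : #|X| < #|A| by apply: proper_card; rewrite properEneq XnA.
  have [||f [injf fE]] := IH X E.
  - exact: leq_trans ltXA leAm.
  - by move=> Y YX; apply/hallA/(subset_trans YX).
  have [||g [injg gE]] := IH (A :\: X) (fun x => E x :\: N).
  - apply: leq_trans leAm; apply: proper_card; rewrite properE subsetDl /=.
    have [x xX] := set0Pn _ X0; apply/subsetPn; exists x; first exact: (subsetP XA).
    by rewrite inE xX.
  - move=> Z ZA.
    have dXZ : [disjoint Z & X].
      by move: ZA; rewrite subsetD => /andP[].
    (* Hall's condition for [X :|: Z], minus the at most [#|X|] neighbours of [X], leaves enough
       neighbours of [Z] outside [N]. *)
    have := hallA (X :|: Z); rewrite subUset XA (subset_trans ZA (subsetDl _ _)).
    rewrite bigcup_setU -/N => /(_ isT).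
    have -> : \bigcup_(x in Z) (E x :\: N) = (\bigcup_(x in Z) E x) :\: N.
      apply/setP=> y; rewrite inE; apply/bigcupP/andP => [[x xZ]|[yN /bigcupP[x xZ yx]]].
        by rewrite inE => /andP[yN yx]; split=> //; apply/bigcupP; exists x.
      by exists x => //; rewrite inE yN.
    have := cardsUI X Z; have := cardsUI N (\bigcup_(x in Z) E x).
    have := cardsID N (\bigcup_(x in Z) E x).
    by move: dXZ; rewrite disjoint_sym -setI_eq0 => /eqP->; rewrite cards0 setIC; lia.
  have fN x : x \in X -> f x \in N by move=> xX; apply/bigcupP; exists x; rewrite ?fE.
  exists (fun x => if x \in X then f x else g x); split=> [x y xA yA|x xA].
    case: ifPn => xX; case: ifPn => yX; first exact: injf.
    - have := gE y; rewrite !inE yX yA => /(_ isT) /andP[gN _] fg.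
      by rewrite -fg fN in gN.
    - have := gE x; rewrite !inE xX xA => /(_ isT) /andP[gN _] fg.
      by rewrite fg fN in gN.
    - by apply: injg; rewrite inE ?xX ?yX.
  case: ifPn => xX; first exact: fE.
  by have := gE x; rewrite !inE xX xA => /(_ isT)/andP[].
have [b bEa] : exists b, b \in E a.
  apply/set0Pn; rewrite -card_gt0.
  by have := hallA [set a]; rewrite sub1set aA big_set1 cards1 => ->.
have [||f [injf fE]] := IH (A :\ a) (fun x => E x :\ b).
- by move: leAm; rewrite (cardsD1 a) aA.
- move=> X XA; have [->|X0] := eqVneq X set0; first by rewrite cards0.
  have XA' : X \subset A by apply: subset_trans XA (subsetDl _ _).
  have XnA : X != A.
    by apply: contraTneq aA => <-; apply/negP=> /(subsetP XA); rewrite !inE eqxx.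
  have := tightN X; rewrite XA' X0 XnA /= -ltnNge => ltX.
  have -> : \bigcup_(x in X) (E x :\ b) = (\bigcup_(x in X) E x) :\ b.
    apply/setP=> y; rewrite !inE; apply/bigcupP/andP => [[x xZ]|[yN /bigcupP[x xZ yx]]].
      by rewrite !inE => /andP[yN yx]; split=> //; apply/bigcupP; exists x.
    by exists x => //; rewrite !inE yN.
  by have := cardsD1 b (\bigcup_(x in X) E x); lia.
have fb x : x \in A -> x != a -> f x != b.
  by move=> xA xa; have := fE x; rewrite !inE xa xA => /(_ isT)/andP[].
exists (fun x => if x == a then b else f x); split=> [x y xA yA|x xA].
  case: eqVneq => [->|xa]; case: eqVneq => [->|ya] //.
  - by move=> /esym/eqP; rewrite (negPf (fb y yA ya)).
  - by move=> /eqP; rewrite (negPf (fb x xA xa)).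
  - by apply: injf; rewrite !inE ?xa ?ya.
case: eqVneq => [->|xa] //.
by have := fE x; rewrite !inE xa xA => /(_ isT)/andP[].
Qed.

(* X maximises the deficiency |X| - |N(X)|, which gives Hall's condition both
   from A - X to the outside of N(X) and from R = N(X) back into X. *)
Lemma konig_cover (aT bT : finType) (a0 : aT) (b0 : bT) (A : {set aT})
    (E : aT -> {set bT}) :
  exists (X : {set aT}) (R B : {set bT}) (g : bT -> aT),
    [/\ X \subset A, [disjoint R & B], #|B| = #|A :\: X|,
        {in X, forall x, E x \subset R}
      & {in R :|: B &, injective g} /\
        {in R :|: B, forall y, g y \in A /\ y \in E (g y)}].
Proof.
pose N (X : {set aT}) := \bigcup_(x in X) E x.
pose P (X : {set aT}) := X \subset A.
(* The deficiency shifted by [#|bT|], so that the subtraction never truncates. *)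
pose w (X : {set aT}) := #|X| + (#|bT| - #|N X|).
have P0 : P set0 by apply: sub0set.
case: (@arg_maxnP _ set0 P w P0) => X XA maxX.
have wE Y : w Y + #|N Y| = #|Y| + #|bT|.
  by rewrite /w -addnA subnK ?max_card.
(* A violating [Z] could be added to [X] and would raise the deficiency. *)
have [|f [injf fE]] := @hall _ _ b0 (A :\: X) (fun x => E x :\: N X).
  move=> Z ZA; have dXZ : [disjoint Z & X].
    by move: ZA; rewrite subsetD => /andP[].
  have := maxX (X :|: Z); rewrite /P subUset [X \subset A]XA (subset_trans ZA (subsetDl _ _)).
  move=> /(_ isT); have := wE X; have := wE (X :|: Z).
  have -> : N (X :|: Z) = N X :|: N Z by rewrite /N bigcup_setU.
  have -> : \bigcup_(x in Z) (E x :\: N X) = N Z :\: N X.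
    apply/setP=> y; rewrite inE; apply/bigcupP/andP => [[x xZ]|[yN /bigcupP[x xZ yx]]].
      by rewrite inE => /andP[yN yx]; split=> //; apply/bigcupP; exists x.
    by exists x => //; rewrite inE yN.
  have := cardsUI X Z; have := cardsUI (N X) (N Z); have := cardsID (N X) (N Z).
  move: dXZ; rewrite disjoint_sym -setI_eq0 => /eqP->; rewrite cards0 setIC.
  rewrite /ge/=. lia.
(* For a violating [Y], deleting its neighbours [F] from [X] loses fewer vertices than neighbours,
   again raising the deficiency. *)
have [|h [injh hE]] := @hall _ _ a0 (N X) (fun y => [set x in X | y \in E x]).
  move=> Y YN; set F := \bigcup_(y in Y) _.
  have FX : F \subset X by apply/bigcupsP=> y _; apply/subsetP=> x; rewrite inE => /andP[].
  have := maxX (X :\: F); rewrite /P (subset_trans (subsetDl _ _) XA) => /(_ isT).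
  have := wE X; have := wE (X :\: F).
  have : N (X :\: F) \subset N X :\: Y.
    apply/subsetP=> y /bigcupP[x]; rewrite !inE => /andP[xF xX] yx.
    have -> : y \in N X by apply/bigcupP; exists x.
    rewrite andbT; apply: contra xF => yY; apply/bigcupP; exists y => //.
    by rewrite inE xX.
  move/subset_leq_card; have := cardsID F X; have := cardsID Y (N X).
  by rewrite (setIidPr FX) (setIidPr YN) /ge/=; lia.
pose B := f @: (A :\: X).
have dRB : [disjoint N X & B].
  rewrite disjoint_sym disjoint_subset; apply/subsetP=> y /imsetP[x xA ->].
  by have := fE x xA; rewrite !inE => /andP[].
(* On [B] this inverts [f]; the default [a0] is not reached there. *)
pose g y := if y \in N X then h y else odflt a0 [pick x in A :\: X | f x == y].
have gB y : y \in B -> g y \in A :\: X /\ f (g y) = y.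
  move=> yB; rewrite /g (disjointFl dRB yB).
  case: pickP => [x /andP[xA /eqP fx]|] //=.
  by case/imsetP: yB => x xA -> /(_ x); rewrite xA eqxx.
have gR y : y \in N X -> g y = h y by rewrite /g => ->.
have hX y : y \in N X -> h y \in X /\ y \in E (h y).
  by move=> /hE; rewrite inE => /andP[].
exists X, (N X), B, g; split=> //.
- by rewrite card_in_imset.
- by move=> x xX; apply: (bigcup_sup x).
split=> [y z|y]; rewrite !inE.
  case/orP=> yR; case/orP=> zR.
  - by rewrite !gR //; apply: injh.
  - rewrite gR // => e; have [] := gB z zR; rewrite -e inE.
    by have [-> _] := hX y yR.
  - rewrite (gR z) // => e; have [] := gB y yR; rewrite e inE.
    by have [-> _] := hX z zR.
  - by move=> e; have [_ <-] := gB y yR; have [_ <-] := gB z zR; rewrite e.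
case/orP=> yR.
  by rewrite gR //; have [xX ?] := hX y yR; split=> //; apply: (subsetP XA).
have [gA fg] := gB y yR; split; first by case/setDP: gA.
by have := fE _ gA; rewrite fg inE => /andP[].
Qed.

(** * Deleting a vertex from a tree without disconnecting it *)

(* A vertex at maximal distance from a root x lies on no shortest path from x
   to another vertex. *)
Lemma noncut_vertex (T : finType) (e : rel T) (x x1 : T) :
  (forall y, connect e x y) -> x1 != x ->
  exists2 v : T, v != x & forall y, y != v ->
    exists p, [/\ path e x p, last x p = y & v \notin p].
Proof.
move=> conn x1x.
pose reach y n := [exists p : n.-tuple T, path e x p && (last x p == y)].
have reachP y : exists n, reach y n.
  have /connectP[p ep ->] := conn y.
  by exists (size p); apply/existsP; exists (in_tuple p); rewrite ep eqxx.
pose dist y := ex_minn (reachP y).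
have distP p : path e x p -> dist (last x p) <= size p.
  move=> ep; rewrite /dist; case: ex_minnP => n _; apply.
  by apply/existsP; exists (in_tuple p); rewrite ep eqxx.
case: (@arg_maxnP _ x1 (predC1 x) dist x1x) => v vx maxv.
exists v => // y yv; have [->|yx] := eqVneq y x; first by exists [::].
have := maxv y yx; rewrite /ge/= {1}/dist.
case: ex_minnP => n /existsP[p /andP[ep /eqP lp]] _ le_nv.
(* If the shortest path to [y] met [v], its part up to [v] would be strictly shorter, so [v] would
   be nearer to [x] than [y]. *)
exists p; split=> //; apply/negP=> vp.
have sp : size p = n by rewrite size_tuple.
move: (tval p) ep lp vp sp => q ep lp vp sq; case/splitPr: vp => q1 q2 in ep lp sq.
move: ep; rewrite -cat_rcons cat_path => /andP[/distP]; rewrite last_rcons size_rcons => d _.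
case: q2 lp sq => [|z q2]; rewrite last_cat /=; first by move=> vy; rewrite vy eqxx in yv.
by move=> _; rewrite size_cat /=; lia.
Qed.

Definition del_vertex (U : finType) (F : hypergraph U) (v : U) :
    hypergraph {u : U | u != v} :=
  [set e : {set {u : U | u != v}} | [set val u | u in e] \in F].

Lemma adj_del_vertex (U : finType) (F : hypergraph U) (v : U) (x y : {u : U | u != v}) :
  adj (del_vertex F v) x y = adj F (val x) (val y).
Proof. by rewrite /adj inE imsetU1 imset_set1. Qed.

Lemma adj_sym (U : finType) (F : hypergraph U) : symmetric (adj F).
Proof. by move=> x y; rewrite /adj setUC. Qed.

(** For [v] farthest from a root, the root reaches all other vertices along paths avoiding [v], and
    these survive in the subtype. Cycles of the remainder are cycles of [S]. *)
Lemma tree_del_vertex (l : nat) (U : finType) (S : hypergraph U) :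
  is_tree S -> #|U| = l.+2 ->
  exists v : U, is_tree (del_vertex S v) /\ #|{: {u : U | u != v}}| = l.+1.
Proof.
move=> [graphS [_ connS] acycS] cardU.
have /card_gt1P[x1 [x0 [_ _ x01]]] : 1 < #|U| by rewrite cardU.
have [v vx0 vP] := noncut_vertex (connS x0) x01.
have cardW : #|{: {u : U | u != v}}| = l.+1.
  by rewrite card_sig; have := cardC1 v; rewrite cardU.
exists v; split=> //; split.
- apply/forall_inP=> e; rewrite inE => /(forall_inP graphS).
  by rewrite card_imset //; apply: val_inj.
- split; first by rewrite cardW.
  have lift (z : {u : U | u != v}) p : path (adj S) (val z) p -> v \notin p ->
      forall y, val y = last (val z) p -> connect (adj (del_vertex S v)) z y.
    elim: p z => [|a p IH] z /=; first by move=> _ _ y /val_inj->.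
    rewrite inE negb_or => /andP[za ap] /andP[va vp] y ly.
    have av : a != v by rewrite eq_sym.
    apply: (@connect_trans _ _ (Sub a av)); last by apply: IH.
    by apply: connect1; rewrite adj_del_vertex.
  have symC : connect_sym (adj (del_vertex S v)).
    by apply: sym_connect_sym; apply: adj_sym.
  have x0v : x0 != v by rewrite eq_sym.
  move=> y z; apply: (@connect_trans _ _ (Sub x0 x0v)).
    rewrite symC; have [p [xp lp vp]] := vP (val y) (valP y).
    by apply: (lift (Sub x0 x0v) p).
  have [p [xp lp vp]] := vP (val z) (valP z).
  by apply: (lift (Sub x0 x0v) p).
- move=> c /andP[cc uc]; rewrite -(size_map val); apply: acycS.
  rewrite /ucycle map_inj_uniq ?uc ?andbT; last exact: val_inj.
  case: c cc {uc} => //= a c; rewrite -map_rcons.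
  by rewrite path_map; apply: sub_path => y z; rewrite /= adj_del_vertex.
Qed.

(** * Embeddings into vertex subsets and the Erdős-Sós bound there *)

(** The target set [W] is explicit so that inductions can pass to neighbourhoods while keeping [G]
    fixed. *)
Definition embeds (U V : finType) (F : hypergraph U) (G : hypergraph V)
    (W : {set V}) : Prop :=
  exists phi : U -> V,
    [/\ injective phi, forall u, phi u \in W
      & forall u v, adj F u v -> adj G (phi u) (phi v)].

Definition nbrs (V : finType) (G : hypergraph V) (W : {set V}) (w : V) : {set V} :=
  [set x in W | adj G w x].

Lemma is_graph_card (V : finType) (G : hypergraph V) (e : {set V}) :
  is_graph G -> e \in G -> #|e| = 2.
Proof. by move=> /forall_inP gG /gG/eqP. Qed.

Lemma graph_adj_neq (V : finType) (G : hypergraph V) (x y : V) :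
  is_graph G -> adj G x y -> x != y.
Proof.
by move=> gG /(is_graph_card gG); apply: contra_eq_neq => ->; rewrite setUid cards1.
Qed.

(* The deleted vertex is sent to w, which is adjacent to the whole image. *)
Lemma embeds_nbrs (U V : finType) (F : hypergraph U) (G : hypergraph V)
    (W : {set V}) (v : U) (w : V) :
  is_graph F -> is_graph G -> w \in W ->
  embeds (del_vertex F v) G (nbrs G W w) -> embeds F G W.
Proof.
move=> gF gG wW [phi [injp pW padj]].
exists (fun u => if insub u is Some u' then phi u' else w).
have wp u : w != phi u.
  by have := pW u; rewrite inE => /andP[_ /(graph_adj_neq gG)].
split=> [x y|u|x y].
- case: insubP => [x' _ <-|]; case: insubP => [y' _ <-|] //.
  + by move=> /injp->.
  + by move=> _ e; have := wp x'; rewrite e eqxx.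
  + by move=> _ e; have := wp y'; rewrite e eqxx.
  + by rewrite !negbK => /eqP-> /eqP->.
- by case: insubP => [u' _ _|//]; have := pW u'; rewrite inE => /andP[].
- have nb u : adj G w (phi u) by have := pW u; rewrite inE => /andP[].
  case: insubP => [x' _ <-|]; case: insubP => [y' _ <-|] //.
  + by rewrite -adj_del_vertex; apply: padj.
  + by move=> _ _; rewrite adj_sym.
  + by rewrite !negbK => /eqP-> /eqP-> /(graph_adj_neq gF); rewrite eqxx.
Qed.

(** Numbering [W] by [enum_val] makes the part of [G] inside [W] a graph on an ordinal, to which the
    conjecture applies; the factor 2 clears its denominator. *)
Lemma erdos_sos_on_subset (l : nat) (U V : finType) (S : hypergraph U)
    (G : hypergraph V) (W : {set V}) :
  erdos_sos_conjecture -> 1 <= l -> is_tree S -> #|U| = l.+1 -> is_graph G ->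
  ~ embeds S G W -> #|[set e in G | e \subset W]| * 2 <= (l - 1) * #|W|.
Proof.
move=> ES l0 treeS cardU gG nemb.
(* The conjecture covers positive orders only; an empty [W] contains no edge. *)
have [W0|Wpos] := posnP #|W|.
  rewrite W0 muln0 leqn0 muln_eq0 orbF cards_eq0; apply/eqP/setP=> e; rewrite !inE.
  apply/negP=> /andP[/(is_graph_card gG) e2 /subset_leq_card].
  by rewrite W0 e2.
pose G' : hypergraph 'I_#|W| := [set e : {set 'I_#|W|} | [set enum_val i | i in e] \in G].
have inj_ev : injective (@enum_val _ (mem W)) by apply: enum_val_inj.
have adjG' i j : adj G' i j = adj G (enum_val i) (enum_val j).
  by rewrite /adj inE imsetU1 imset_set1.
have card_G' : #|G'| = #|[set e in G | e \subset W]|.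
  rewrite -(card_imset (mem G') (imset_inj inj_ev)); congr #|pred_of_set _|.
  apply/setP=> e; rewrite inE; apply/imsetP/andP => [[e' + ->]|[eG eW]].
    rewrite inE => -> ; split=> //.
    by apply/subsetP=> x /imsetP[i _ ->]; apply: enum_valP.
  have ee : e = enum_val @: [set i : 'I_#|W| | enum_val i \in e].
    apply/setP=> x; apply/idP/imsetP => [xe|[i + ->]]; last by rewrite inE.
    have xW := subsetP eW x xe.
    by exists (enum_rank_in xW x); rewrite ?inE enum_rankK_in.
  by exists [set i : 'I_#|W| | enum_val i \in e]; rewrite ?inE -?ee.
have gG' : is_graph G'.
  apply/forall_inP=> e; rewrite inE => /(is_graph_card gG).
  by rewrite card_imset // => ->.
have nS : ~~ contains_subgraph S G'.
  apply/negP=> /existsP[phi /andP[/injectiveP injp /forallP hp]]; apply: nemb.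
  exists (fun u => enum_val (phi u)); split=> [x y /inj_ev/injp //|u|u v uv].
    exact: enum_valP.
  by rewrite -adjG'; move/forallP: (hp u) => /(_ v)/implyP; apply.
have exG : #|G'| <= ex #|W| S.
  by rewrite /ex; apply: (leq_bigmax_cond (P := fun G => _ G && ~~ _ G)); rewrite gG' nS.
have := ES l U S #|W| l0 treeS cardU Wpos.
rewrite -card_G' -(@Num.Theory.ler_nat rat) !GRing.natrM GRing.natrB //.
move=> h; apply: Order.POrderTheory.le_trans (_ : ((ex #|W| S)%:R * 2%:R <= _)%R).
  by apply: Num.Theory.ler_wpM2r => //; rewrite Num.Theory.ler_nat.
apply: Order.POrderTheory.le_trans (Num.Theory.ler_wpM2r _ h) _ => //.
by rewrite GRing.mulrAC GRing.mulfVK.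
Qed.

(** * Clique counts in tree-free graphs *)

Lemma double_count (I J : finType) (A : {set I}) (B : {set J}) (P : I -> J -> bool) :
  \sum_(i in A) #|[set j in B | P i j]| = \sum_(j in B) #|[set i in A | P i j]|.
Proof.
transitivity (\sum_(i in A) \sum_(j in B | P i j) 1).
  by apply: eq_bigr => i _; rewrite sum1dep_card; apply: eq_card => j; rewrite !inE.
rewrite (exchange_big_dep (mem B)) /=; last by move=> i j _ /andP[].
apply: eq_bigr => j jB; rewrite sum1dep_card; apply: eq_card => i.
by rewrite !inE jB.
Qed.

Definition cliques (V : finType) (G : hypergraph V) (s : nat) (W : {set V}) :
    {set {set V}} :=
  [set K : {set V} | [&& K \subset W, #|K| == s
            & [forall x in K, forall y in K, (x != y) ==> adj G x y]]].

(** Degree sum inside [W]: each edge is counted at most once from each of its two ends. *)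
Lemma sum_nbrs (V : finType) (G : hypergraph V) (W : {set V}) :
  is_graph G -> \sum_(w in W) #|nbrs G W w| <= #|[set e in G | e \subset W]| * 2.
Proof.
move=> gG; set EW := [set e in G | e \subset W].
apply: leq_trans (_ : \sum_(w in W) #|[set e in EW | w \in e]| <= _).
  apply: leq_sum => w wW.
  rewrite -(@card_in_imset _ _ (fun x => [set w; x])) => [|x y].
    apply/subset_leq_card/subsetP=> e /imsetP[x + ->]; rewrite !inE eqxx => /andP[xW].
    by rewrite /adj => ->; rewrite subUset !sub1set wW xW.
  rewrite !inE => /andP[_ /(graph_adj_neq gG) wx] /andP[_ /(graph_adj_neq gG) wy] e.
  have : x \in [set w; y] by rewrite -e !inE eqxx orbT.
  by rewrite !inE eq_sym (negPf wx) => /eqP.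
rewrite double_count -sum_nat_const; apply: leq_sum => e; rewrite inE => /andP[eG _].
rewrite -(is_graph_card gG eG); apply/subset_leq_card/subsetP=> x.
by rewrite inE => /andP[].
Qed.

(** A clique is counted once at each of its [s.+1] vertices [w], and [K :\ w] is a clique in the
    neighbourhood of [w] that determines [K]. *)
Lemma cliques_rec (V : finType) (G : hypergraph V) (s : nat) (W : {set V}) :
  s.+1 * #|cliques G s.+1 W| <= \sum_(w in W) #|cliques G s (nbrs G W w)|.
Proof.
apply: leq_trans (_ : \sum_(w in W) #|[set K in cliques G s.+1 W | w \in K]| <= _).
  rewrite double_count mulnC -sum_nat_const; apply: leq_sum => K.
  rewrite inE => /and3P[/subsetP KW /eqP <- _]; apply/subset_leq_card/subsetP=> x xK.
  by rewrite inE KW.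
apply: leq_sum => w wW.
rewrite -(@card_in_imset _ _ (fun K => K :\ w)) => [|K L].
  apply/subset_leq_card/subsetP=> _ /imsetP[K + ->].
  rewrite 2!inE => /andP[/and3P[/subsetP KW /eqP cK /forall_inP clK] wK].
  have clP x y : x \in K -> y \in K -> x != y -> adj G x y.
    by move=> xK yK; apply/implyP; move/forall_inP: (clK x xK); apply.
  rewrite inE; apply/and3P; split.
  - apply/subsetP=> x; rewrite !inE => /andP[xw xK]; rewrite KW //=.
    by apply: clP; rewrite // eq_sym.
  - by move: cK; rewrite (cardsD1 w) wK add1n => -[->].
  - apply/forall_inP=> x /setD1P[_ xK]; apply/forall_inP=> y /setD1P[_ yK].
    by apply/implyP; apply: clP.
by rewrite !inE => /andP[_ wK] /andP[_ wL] e; rewrite -(setD1K wK) -(setD1K wL) e.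
Qed.

(** With [v] as in [tree_del_vertex], [S] minus [v] embeds in no neighbourhood, so the assumed bound
    applies there; summing over [w] turns the neighbourhood sizes into edges. It serves both the
    induction on clique size and the final count, where red edges must stay visible. *)
Lemma clique_edge_bound (s l : nat) (U V : finType) (S : hypergraph U)
    (G : hypergraph V) (W : {set V}) :
  (forall (U' : finType) (S' : hypergraph U') (W' : {set V}),
    is_tree S' -> #|U'| = l.+2 -> ~ embeds S' G W' ->
    l.+1 * #|cliques G s W'| <= #|W'| * 'C(l.+1, s)) ->
  is_tree S -> #|U| = l.+3 -> is_graph G -> ~ embeds S G W ->
  l.+1 * (s.+1 * #|cliques G s.+1 W|) <=
    #|[set e in G | e \subset W]| * 2 * 'C(l.+1, s).
Proof.
move=> IH treeS cardU gG nemb.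
have [v [treeSv cardSv]] := tree_del_vertex treeS cardU.
apply: leq_trans (leq_mul (sum_nbrs W gG) (leqnn _)).
apply: leq_trans (leq_mul (leqnn _) (cliques_rec G s W)) _.
rewrite big_distrr big_distrl /=; apply: leq_sum => w wW.
apply: IH treeSv cardSv _ => /embeds_nbrs-emb.
by apply/nemb/emb => //; case: treeS.
Qed.

(** Induction on [s]: the bound by edges is combined with the Erdős-Sós bound on their number. The
    base counts singletons. *)
Lemma clique_bound (s l : nat) (U V : finType) (S : hypergraph U)
    (G : hypergraph V) (W : {set V}) :
  erdos_sos_conjecture -> is_graph G -> 1 <= s ->
  is_tree S -> #|U| = l.+2 -> ~ embeds S G W ->
  l.+1 * #|cliques G s W| <= #|W| * 'C(l.+1, s).
Proof.
move=> ES gG; case: s => // s _.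
elim: s l U S W => [|s IH] l U S W treeS cardU nemb.
  rewrite bin1 mulnC leq_mul // -[leqRHS](card_imset (mem W) (@set1_inj _)).
  apply/subset_leq_card/subsetP=> K; rewrite inE => /and3P[KW /cards1P[x Kx] _].
  by move: KW; rewrite Kx sub1set => xW; apply/imsetP; exists x.
have := erdos_sos_on_subset ES _ treeS cardU gG nemb => /(_ isT).
(* For [l = 0] the tree has two vertices, and Erdős-Sós leaves no edge in [W], hence no clique of
   size at least 2. *)
case: l cardU => [|l] cardU ES_W.
  rewrite bin_small // muln0 mul1n leqn0.
  rewrite leqn0 muln_eq0 /= orbF cards_eq0 in ES_W.
  rewrite cards_eq0; apply/eqP/setP=> K; rewrite in_set0; apply/negP.
  rewrite inE => /and3P[KW /eqP cK /forall_inP clK].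
  have /card_gt1P[x [y [xK yK xy]]] : 1 < #|K| by rewrite cK.
  have: [set x; y] \in [set e in G | e \subset W].
    rewrite inE subUset !sub1set !(subsetP KW) //= andbT.
    exact: (implyP (forall_inP (clK x xK) y yK) xy).
  by rewrite (eqP ES_W) inE.
have := clique_edge_bound (IH l) treeS cardU gG nemb.
move/leq_trans=> /(_ _ (leq_mul ES_W (leqnn _))).
rewrite subn1 /= -!mulnA leq_pmul2l // => le1.
(* The factor [l.+2] is absorbed by [l.+2 * 'C(l.+1, s.+1) = s.+2 * 'C(l.+2, s.+2)], after which
   [s.+2] cancels. *)
have := leq_mul (leqnn l.+2) le1.
rewrite mulnCA (mulnCA l.+2 #|W|) mul_bin_diag (mulnCA #|W|) leq_pmul2l //.
Qed.

(** * Binomial comparisons separating the two ranges of [k] *)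

Lemma leq_bin_middle (m j : nat) : 0 < j < m -> m <= 'C(m, j).
Proof.
elim: m j => // m IH [//|j] /andP[_]; rewrite ltnS leq_eqVlt => /orP[/eqP <-|ltjm].
  by rewrite binSn.
have := IH j.+1; rewrite ltjm binS => /(_ isT).
have : 0 < 'C(m, j) by rewrite bin_gt0; lia.
lia.
Qed.

(** Used with [m = k - 1] and [s = r - 1], where [s.+2 <= m] means [k > r + 1]. Equality holds at
    [m = s.+2], and the right side then grows faster. *)
Lemma leq_bin_large (m s : nat) : 1 < s -> s.+2 <= m -> m * s.+1 <= 2 * 'C(m, s).
Proof.
move=> s2; elim: m => // m IH; rewrite leq_eqVlt => /orP[/eqP[<-]|lesm].
  rewrite -bin_sub; last by lia.
  have -> : s.+2 - s = 2 by lia.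
  by have := mul_bin_diag s.+2 1; rewrite bin1 /= => ->.
case: s s2 IH lesm => // s s2 IH lesm; rewrite binS.
have := IH lesm; have : m <= 'C(m, s) by apply: leq_bin_middle; lia.
nia.
Qed.

Lemma geq_bin_small (m s : nat) : 0 < s -> m <= s.+1 -> 2 * 'C(m, s) <= m * s.+1.
Proof.
move=> s0; rewrite leq_eqVlt => /orP[/eqP->|]; first by rewrite binSn; nia.
rewrite ltnS leq_eqVlt => /orP[/eqP->|ltms]; first by rewrite binn; nia.
by rewrite bin_small.
Qed.

(** * Upper bounds for Berge-tree-free hypergraphs *)

Lemma contains_berge_of_matching (U V : finType) (T : hypergraph U)
    (H G : hypergraph V) (g : {set V} -> {set V}) :
  {in G &, injective g} -> {in G, forall e, g e \in H /\ e \subset g e} ->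
  is_graph T -> embeds T G [set: V] -> contains_berge T H.
Proof.
move=> injg gE gT [phi [injp _ padj]].
have imG e : e \in T -> phi @: e \in G.
  move=> eT; have /cards2P[x [y [_ e_xy]]] : #|e| == 2 by rewrite (is_graph_card gT eT).
  by rewrite e_xy imsetU1 imset_set1; apply: padj; rewrite /adj -e_xy.
have phiE u v : [set finfun phi u; finfun phi v] = phi @: [set u; v].
  by rewrite !ffunE imsetU1 imset_set1.
apply/existsP; exists (finfun phi); apply/existsP.
exists [ffun e : {set U} => g (phi @: e)]; apply/and4P; split.
- by apply/injectiveP=> x y; rewrite !ffunE => /injp.
- apply/dinjectiveP=> x y xT yT; rewrite !ffunE => gxy.
  by apply: (imset_inj injp); apply: injg gxy; apply: imG.
- by apply/forall_inP=> e eT; rewrite ffunE; case: (gE _ (imG e eT)).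
- apply/forallP=> u; apply/forallP=> v; apply/implyP=> uv.
  by rewrite phiE ffunE; case: (gE _ (imG _ uv)).
Qed.

Lemma berge_free_bound (k r : nat) (U V : finType) (T : hypergraph U)
    (H : hypergraph V) :
  erdos_sos_conjecture -> 1 <= k -> 2 <= r -> is_tree T -> #|U| = k.+1 ->
  uniform r H -> ~~ contains_berge T H ->
  [/\ r.+2 <= k -> 3 <= r -> k * #|H| <= #|V| * 'C(k, r)
    & k <= r.+1 -> #|H| * 2 <= (k - 1) * #|V|].
Proof.
move=> ES k1 r2 treeT cardU /forall_inP unifH nberge.
have [gT _ _] := treeT.
pose E (h : {set V}) := [set e : {set V} | (#|e| == 2) && (e \subset h)].
have [X [R [B [g [XH dRB cardB ER [injg gE]]]]]] := konig_cover set0 set0 H E.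
set G := R :|: B in injg gE.
have gG : is_graph G.
  by apply/forall_inP=> e /gE[_]; rewrite inE => /andP[].
have gR : is_graph R.
  by apply/forall_inP=> e eR; rewrite (is_graph_card gG) // inE eR.
have nembG : ~ embeds T G [set: V].
  move=> emb; move/negP: nberge; apply.
  apply: (contains_berge_of_matching injg _ gT emb) => e /gE[gH].
  by rewrite inE => /andP[].
have nembR : ~ embeds T R [set: V].
  move=> [phi [ip pW padj]]; apply: nembG; exists phi; split=> // u v /padj.
  by rewrite /adj inE => ->.
have cardH : #|H| <= #|B| + #|cliques R r setT|.
  rewrite cardB -(cardsID X H) (setIidPr XH) addnC leq_add2l.
  apply/subset_leq_card/subsetP=> h hX; rewrite inE subsetT unifH ?(subsetP XH) //=.
  apply/forall_inP=> x xh; apply/forall_inP=> y yh; apply/implyP=> xy.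
  by apply: (subsetP (ER h hX)); rewrite inE cards2 xy subUset !sub1set xh yh.
have cardG : #|B| + #|R| = #|G|.
  by rewrite /G cardsU disjoint_setI0 // cards0 subn0 addnC.
have subT (F : hypergraph V) : [set e in F | e \subset [set: V]] = F.
  by apply/setP=> e; rewrite inE subsetT andbT.
have := erdos_sos_on_subset ES k1 treeT cardU gG nembG.
rewrite subT cardsT -cardG => boundG.
case: r r2 unifH cardH => // s s1 _ cardH.
(* For [k = 1] there are too few vertices for [clique_edge_bound]; here [R] has no [r]-clique and
   [B] is empty. *)
case: k k1 cardU boundG => // -[|l] _ cardU boundG.
  split=> // _; apply: leq_trans (leq_mul cardH (leqnn _)) _.
  have := clique_bound ES gR isT treeT cardU nembR (s := s.+1).
  by rewrite bin_small //; lia.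
have := clique_edge_bound (fun U' S' W' => clique_bound ES gR s1) treeT cardU gR nembR.
rewrite subT => boundR; rewrite subn1 /= in boundG *.
move: cardH boundG boundR.
move: #|H| #|B| #|R| #|V| #|cliques R s.+1 setT| => h b m n q cardH boundG boundR.
split=> [lek s2|lek].
(* A red edge contributes at most [2 * 'C(k-1, r-1) / ((k-1) * r)] cliques on average, a blue edge
   one hyperedge. Here the red weight is at least 1, so blue edges may be given it too; in the other
   range it is at most 1, and all edges get weight 1. *)
- have C2 : l.+1 * s.+1 <= 2 * 'C(l.+1, s).
    by apply: leq_bin_large; lia.
  have : l.+1 * (s.+1 * h) <= l.+1 * (n * 'C(l.+1, s)).
    have := leq_mul (leqnn (l.+1 * s.+1)) cardH; have := leq_mul C2 (leqnn b).
    by have := leq_mul (leqnn 'C(l.+1, s)) boundG; lia.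
  rewrite leq_pmul2l // -(leq_pmul2l (ltn0Sn l.+1)) => bH.
  by rewrite -(leq_pmul2l (ltn0Sn s)); have := mul_bin_diag l.+2 s; rewrite /=; nia.
- have C2 : 2 * 'C(l.+1, s) <= l.+1 * s.+1.
    by apply: geq_bin_small; lia.
  have : l.+1 * (s.+1 * h) <= l.+1 * (s.+1 * (b + m)).
    have := leq_mul (leqnn (l.+1 * s.+1)) cardH; have := leq_mul C2 (leqnn m).
    by lia.
  rewrite !leq_pmul2l // => bH.
  by lia.
Qed.

(** * Sharpness: disjoint complete hypergraphs *)

Lemma ex_berge_disjoint_cliques (k r n : nat) (U : finType) (T : hypergraph U) :
  is_tree T -> #|U| = k.+1 -> 1 <= k -> 1 <= r -> k %| n ->
  n %/ k * 'C(k, r) <= ex_berge r n T.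
Proof.
move=> [_ [_ connT] _] cardU k0 r0 /dvdnP[q ->]; rewrite mulnK //.
pose block b : {set 'I_(q * k)} := [set i : 'I_(q * k) | i %/ k == b].
pose H : hypergraph 'I_(q * k) :=
  [set e : {set 'I_(q * k)} | (#|e| == r) && [exists b : 'I_q, e \subset block b]].
have card_block (b : 'I_q) : #|block b| = k.
  have lt_b (j : 'I_k) : b * k + j < q * k.
    by have := ltn_ord b; have := ltn_ord j; nia.
  rewrite -[RHS]card_ord -(card_imset _ (f := fun j => Ordinal (lt_b j))).
    apply: eq_card => i; rewrite inE; apply/eqP/imsetP => [ib|[j _ ->]].
      exists (Ordinal (ltn_pmod i k0)) => //; apply/val_inj => /=.
      by rewrite -ib -divn_eq.
    by rewrite /= divnMDl // divn_small ?addn0.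
  by move=> i j /(congr1 val)/=/addnI/val_inj.
have blockH e : e \in H -> exists b : 'I_q, e \subset block b.
  by rewrite inE => /andP[_ /existsP].
have cardH : q * 'C(k, r) <= #|H|.
  have -> : q * 'C(k, r) = \sum_(b in [set: 'I_q]) #|[set e in H | e \subset block b]|.
    rewrite -[q in LHS]card_ord -cardsT -sum_nat_const; apply: eq_bigr => b _.
    transitivity #|[set e : {set _} | e \subset block b & #|e| == r]|.
      by rewrite cards_draws card_block.
    apply: eq_card => e; rewrite !inE.
    case eb : (e \subset _); rewrite ?andbF //= !andbT.
    by rewrite [X in _ && X](_ : _ = true) ?andbT //; apply/existsP; exists b.
  (* A hyperedge is nonempty since [r] is positive, so it lies in at most one block and is counted
     at most once. *)
  rewrite double_count.
  rewrite -sum1_card; apply: leq_sum => e; rewrite inE => /andP[/eqP er _].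
  have /card_gt0P[i ie] : 0 < #|e| by rewrite er.
  apply/card_le1_eqP=> b c; rewrite !inE => /subsetP/(_ i ie) ib /subsetP/(_ i ie) ic.
  by apply: val_inj; move: ib ic; rewrite !inE => /eqP + /eqP + /= => <-.
apply: leq_trans cardH _; rewrite /ex_berge.
apply: (leq_bigmax_cond (P := fun G => _ G && ~~ _ G)); apply/andP; split.
  by apply/forall_inP=> e; rewrite inE => /andP[].
apply/negP=> /existsP[phi /existsP[f /and4P[/injectiveP injp _ /forall_inP fH /forallP sub]]].
(* The hyperedge assigned to an edge of [T] stays in one block; connectedness then puts all of [T]
   into that block. *)
have same u v : adj T u v -> phi u %/ k = phi v %/ k.
  move=> uv; have [b /subsetP eb] := blockH _ (fH _ uv).
  have /subsetP s : [set phi u; phi v] \subset f [set u; v].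
    by move/forallP: (sub u) => /(_ v)/implyP; apply.
  have := eb _ (s _ (set21 _ _)); have := eb _ (s _ (set22 _ _)).
  by rewrite !inE => /eqP-> /eqP->.
have same_all u v : phi u %/ k = phi v %/ k.
  have /connectP[p + ->] := connT u v.
  by elim: p u => //= w p IH u /andP[/same-> /IH].
have /card_gt0P[u0 _] : 0 < #|U| by rewrite cardU.
have lt_b : phi u0 %/ k < q by rewrite ltn_divLR.
have : phi @: [set: U] \subset block (Ordinal lt_b).
  by apply/subsetP=> _ /imsetP[u _ ->]; rewrite inE /= (same_all u u0).
by move/subset_leq_card; rewrite card_imset // card_block cardsT cardU ltnn.
Qed.

(** * From hypergraph counts to the rational bounds *)

Theorem theorem7 :
  erdos_sos_conjecture ->
  forall (k r : nat) (U : finType) (T : hypergraph U) (n : nat),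
    1 <= k -> 2 <= r -> is_tree T -> #|U| = k.+1 -> 0 < n ->
    (k > r + 1 /\ r + 1 > 3 ->
       ((ex_berge r n T)%:R <= n%:R / k%:R * ('C(k, r))%:R :> rat)%R /\
       (k %| n ->
          ((ex_berge r n T)%:R = n%:R / k%:R * ('C(k, r))%:R :> rat)%R)) /\
    (k <= r + 1 ->
       ((ex_berge r n T)%:R <= (k%:R - 1) / 2%:R * n%:R :> rat)%R).
Proof.
move=> ES k r U T n k1 r2 treeT cardU n0.
have k_gt0 : (0 < k%:R :> rat)%R by rewrite Num.Theory.ltr0n.
have bound P : (forall H : hypergraph 'I_n, uniform r H -> ~~ contains_berge T H ->
    #|H| <= P) -> ex_berge r n T <= P.
  by move=> bP; apply/bigmax_leqP=> H /andP[]; apply: bP.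
have upperE : k > r + 1 /\ r + 1 > 3 -> k * ex_berge r n T <= n * 'C(k, r).
  (* Dividing by [k] with rounding down gives a bound on the maximum itself, which can be checked
     for each hypergraph. *)
  rewrite !addn1 => -[rk r3]; rewrite mulnC -leq_divRL //; apply: bound => H uH fH.
  have [le _] := berge_free_bound ES k1 r2 treeT cardU uH fH.
  by rewrite leq_divRL // mulnC -[n in leqRHS]card_ord; apply: le.
split=> [large|small]; last first.
  have : ex_berge r n T * 2 <= (k - 1) * n.
    rewrite -leq_divRL //; apply: bound => H uH fH.
    have [_ le] := berge_free_bound ES k1 r2 treeT cardU uH fH.
    by rewrite leq_divRL // -[n in leqRHS]card_ord; apply: le; rewrite -addn1.
  rewrite -(@Num.Theory.ler_nat rat) !GRing.natrM GRing.natrB //.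
  by rewrite GRing.mulrAC Num.Theory.ler_pdivlMr.
have rhsE : (n%:R / k%:R * ('C(k, r))%:R = (n * 'C(k, r))%:R / k%:R :> rat)%R.
  by rewrite GRing.natrM GRing.mulrAC.
have upper : ((ex_berge r n T)%:R <= n%:R / k%:R * ('C(k, r))%:R :> rat)%R.
  rewrite rhsE Num.Theory.ler_pdivlMr // -GRing.natrM Num.Theory.ler_nat mulnC.
  exact: upperE.
split=> // kn; apply/Order.POrderTheory.le_anti/andP; split=> //.
rewrite rhsE Num.Theory.ler_pdivrMr // -GRing.natrM Num.Theory.ler_nat.
rewrite -[n in leqLHS](divnK kn) mulnAC leq_pmul2r //.
by apply: ex_berge_disjoint_cliques; rewrite ?(ltnW r2).
Qed.
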